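(* Let $p_1=1$ and $p_n=|\phi_n(5)|$ for $n\ge 2$. Then for every integer $n\ge 1$ the Fibonacci number $F_n$ factors as $$F_n=\prod_{d\mid n}p_d.$$
   Context: The Fibonacci numbers are defined by $F_0=0$, $F_1=1$, $F_n=F_{n-1}+F_{n-2}$ for $n\ge 2$. The polynomials $\phi_n(x)$ are defined by $\phi_1(x)=x$, $\phi_2(x)=x-4$, and for $n\ge 3$ by $\phi_n(x)=\prod_{\gcd(j,n)=1,\ 0<j<n/2}\left(x-4\sin^2\left(\frac{j\pi}{n}\right)\right)$, which is the minimal polynomial over $\mathbb{Q}$ of $4\sin^2\left(\frac{\pi}{n}\right)$. The product runs over the positive divisors $d$ of $n$. *)

(* Defs.v *)
From mathcomp Require Import all_boot all_order all_algebra.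
From mathcomp Require Import reals trigo.

Set Implicit Arguments.
Unset Strict Implicit.
Unset Printing Implicit Defensive.

Import Order.TTheory GRing.Theory Num.Theory.
Local Open Scope ring_scope.

Fixpoint fib (n : nat) : nat :=
  match n with
  | 0 => 0%N
  | 1 => 1%N
  | (m.+1 as k).+1 => (fib k + fib m)%N
  end.

(* The bound j < n / 2 is that of the rationals, hence 2 * j < n rather than
   a comparison with n./2, which would lose j = (n - 1) / 2 for n odd.
   The value at n = 0 is irrelevant. *)
Definition phi (R : realType) (n : nat) : {poly R} :=
  match n with
  | 1 => 'X
  | 2 => 'X - 4%:P
  | _ => \prod_(j < n | [&& coprime j n, (0 < j)%N & (2 * j < n)%N])
           ('X - (4 * sin (j%:R * pi / n%:R) ^+ 2)%:P)
  end.

(* The value at n = 0 is irrelevant. *)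
Definition p_ (R : realType) (n : nat) : R :=
  if n == 1%N then 1 else `|(phi R n).[5]|.

(* Main.v *)
Require Import Defs.
From mathcomp Require Import all_boot all_order all_algebra.
From mathcomp Require Import reals trigo.
From mathcomp Require Import ring lra zify.

Import Order.TTheory GRing.Theory Num.Theory.
Local Open Scope ring_scope.

(** Put q_n = the product of 1 + 4 cos^2 (j pi / n) over all 0 < j < n / 2.
    Since 5 - 4 sin^2 = 1 + 4 cos^2, the number p_d is the part of this
    product, taken at d, with j prime to d ([p_prod_cos]).  A fraction j / n
    has a unique reduced form i / d with d a divisor of n, and reducing it
    preserves both the angle and the condition j < n / 2; so q_n is the product
    of the p_d over the divisors d of n ([big_lowest_terms]).

    What remains is the classical F_n = q_n ([fib_prod_cos]).  The polynomials
    P_0 = 0, P_1 = 1, P_(n+2) = P_(n+1) + X P_n take the value F_n at 1 and,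
    for n > 0, the value 1 at 0.  At X = -1 / (2 cos t)^2 the recurrence becomes,
    up to a power of 2 cos t, the one satisfied by sin (n t)
    ([fibpoly_trig]), so that -1 / (4 cos^2 (j pi / n)) is a root of P_n for
    0 < j < n / 2.  These roots are as many as the degree allows, whence P_n is
    the product of the factors 1 + 4 cos^2 (j pi / n) X ([fibpoly_prod]), to be
    evaluated at 1.  Working with X rather than with the argument 2 cos t of
    the Chebyshev polynomials keeps everything real: F_n corresponds to
    2 cos t = i. *)

(** * Fibonacci polynomials *)

Lemma nat_ind2 (P : nat -> Prop) :
  P 0%N -> P 1%N -> (forall n, P n -> P n.+1 -> P n.+2) -> forall n, P n.
Proof.
move=> P0 P1 PS n; suff [] : P n /\ P n.+1 by [].
by elim: n => [|n [IH0 IH1]]; split=> //; apply: PS.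
Qed.

(** The Jacobsthal polynomials, which are the Chebyshev polynomials of the
    second kind up to a change of variable. *)
Fixpoint fibpoly (R : nzRingType) (n : nat) : {poly R} :=
  match n with
  | 0 => 0
  | 1 => 1
  | (m.+1 as k).+1 => fibpoly R k + 'X * fibpoly R m
  end.

Lemma fibpolySS (R : nzRingType) n :
  fibpoly R n.+2 = fibpoly R n.+1 + 'X * fibpoly R n.
Proof. by []. Qed.

Lemma fibpoly_horner1 (R : comNzRingType) n : (fibpoly R n).[1] = (fib n)%:R.
Proof.
elim/nat_ind2: n => [||n IH0 IH1]; [exact: horner0|exact: hornerC|].
by rewrite fibpolySS !hornerE IH0 IH1 -natrD.
Qed.

Lemma fibpoly_horner0 (R : comNzRingType) n : (fibpoly R n.+1).[0] = 1.
Proof.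
elim: n => [|n IH]; first exact: hornerC.
by rewrite fibpolySS !hornerE IH.
Qed.

Lemma size_fibpoly (R : idomainType) n : (size (fibpoly R n) <= uphalf n)%N.
Proof.
elim/nat_ind2: n => [||n IH0 IH1]; rewrite ?size_poly0 ?size_poly1//.
rewrite fibpolySS (leq_trans (size_polyD _ _))// geq_max.
rewrite (leq_trans IH1) ?uphalf_leq//= mulrC.
rewrite (leq_trans (size_polyMleq _ _))// size_polyX addn2 /=.
exact: IH0.
Qed.

(** Both sides satisfy u_(n+2) = (2 cos t) u_(n+1) - u_n and agree at 0 and 1.
    The factor 2 cos t on the right makes the exponent on the left n instead of
    n - 1, so that n = 0 is not special. *)
Lemma fibpoly_trig (R : realType) (t : R) n : cos t != 0 ->
  (2 * cos t) ^+ n * (fibpoly R n).[- (4 * cos t ^+ 2)^-1] * sin t =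
  2 * cos t * sin (n%:R * t).
Proof.
move=> ct0; elim/nat_ind2: n => [||n IH0 IH1].
- by rewrite horner0 mulr0 !mul0r sin0 mulr0.
- by rewrite /= hornerC expr1 mulr1 mul1r.
have sinSS : sin (n.+2%:R * t) = 2 * cos t * sin (n.+1%:R * t) - sin (n%:R * t).
  have -> : n.+2%:R * t = n.+1%:R * t + t by rewrite -natr1; ring.
  have -> : n%:R * t = n.+1%:R * t - t by rewrite -natr1; ring.
  by rewrite sinD sinB; ring.
rewrite sinSS mulrBr -IH1 -IH0 fibpolySS hornerD hornerM hornerX.
by rewrite !exprS; field.
Qed.

(** * The angles j pi / n with 0 < j < n / 2 *)

Lemma acute_angle (R : realType) (n j : nat) :
  (0 < j)%N -> (2 * j < n)%N -> 0 < (j%:R * pi / n%:R : R) < pi / 2.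
Proof.
move=> j_gt0 jn; have pi0 := pi_gt0 R.
have n0 : 0 < n%:R :> R by rewrite ltr0n; lia.
apply/andP; split; first by rewrite divr_gt0 ?mulr_gt0 ?n0 ?ltr0n.
rewrite ltr_pdivrMr// mulrAC ltr_pdivlMr//.
by rewrite -mulrA mulrCA ltr_pM2l// mulrC -natrM ltr_nat.
Qed.

Lemma cos_acute_gt0 (R : realType) (n j : nat) :
  (0 < j)%N -> (2 * j < n)%N -> 0 < cos (j%:R * pi / n%:R : R).
Proof.
move=> j_gt0 jn; have /andP[a0 a1] := acute_angle R _ _ j_gt0 jn.
by rewrite cos_gt0_pihalf// a1 andbT; lra.
Qed.

(** By [fibpoly_trig], because sin (j pi) = 0 while neither the cosine nor the
    sine of an acute angle vanishes. *)
Lemma fibpoly_root (R : realType) (n j : nat) :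
  (0 < j)%N -> (2 * j < n)%N ->
  root (fibpoly R n) (- (4 * cos (j%:R * pi / n%:R) ^+ 2)^-1).
Proof.
move=> j_gt0 jn; set t := _ / _.
have ct : 0 < cos t by apply: cos_acute_gt0.
have st : 0 < sin t by apply/sin_gt0_pihalf/acute_angle.
have := fibpoly_trig _ t n (lt0r_neq0 ct).
have -> : n%:R * t = j%:R * pi.
  by rewrite /t mulrC divfK// pnatr_eq0; lia.
have -> : sin (j%:R * pi) = 0 :> R.
  elim: (j) => [|k IH]; first by rewrite mul0r sin0.
  by rewrite -natr1 mulrDl mul1r sinDpi IH oppr0.
move/eqP; rewrite mulr0 !mulf_eq0 expf_eq0 mulf_eq0 pnatr_eq0.
by rewrite (gt_eqF ct) (gt_eqF st) /= andbF orbF.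
Qed.

Lemma cos_sqr_inj (R : realType) (n i j : nat) :
  (0 < i)%N -> (2 * i < n)%N -> (0 < j)%N -> (2 * j < n)%N ->
  cos (i%:R * pi / n%:R : R) ^+ 2 = cos (j%:R * pi / n%:R) ^+ 2 -> i = j.
Proof.
move=> i0 iN j0 jN /eqP; have pi0 := pi_gt0 R.
rewrite eqrXn2 ?ltW ?cos_acute_gt0// => /eqP /cos_inj.
have inpi k : (0 < k)%N -> (2 * k < n)%N -> (k%:R * pi / n%:R : R) \in `[0, pi].
  move=> k0 kN; have /andP[a0 a1] := acute_angle R _ _ k0 kN.
  by rewrite in_itv /=; apply/andP; split; lra.
have n0 : n%:R != 0 :> R by rewrite pnatr_eq0; lia.
move=> /(_ (inpi _ i0 iN) (inpi _ j0 jN)) /(mulIf (invr_neq0 n0)).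
by move=> /(mulIf (lt0r_neq0 pi0)) /eqP; rewrite eqr_nat => /eqP.
Qed.

(** * Factorization of the Fibonacci polynomials *)

Lemma poly_eq_roots (R : idomainType) (p q : {poly R}) (rs : seq R) :
  uniq rs -> (size p <= size rs)%N -> (size q <= size rs)%N ->
  {in rs, forall x, p.[x] = q.[x]} -> p = q.
Proof.
move=> urs sp sq pq; apply/eqP; rewrite -subr_eq0; apply: contraT => d0.
have : (size rs < size (p - q)%R)%N.
  apply: max_poly_roots => //; apply/allP => x xrs.
  by rewrite rootE hornerE hornerN pq// subrr.
by rewrite ltnNge (leq_trans (size_polyD _ _))// geq_max size_polyN sp.
Qed.

Lemma size_prod_affine (R : comNzRingType) (I : Type) (s : seq I) (a : I -> R) :
  (size (\prod_(i <- s) (1 + a i *: 'X))%R <= (size s).+1)%N.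
Proof.
elim: s => [|i s IH]; first by rewrite big_nil size_poly1.
have szi : (size (1 + a i *: 'X)%R <= 2)%N.
  rewrite (leq_trans (size_polyD _ _))// geq_max size_poly1 /=.
  by rewrite (leq_trans (size_scale_leq _ _))// size_polyX.
rewrite big_cons (leq_trans (size_polyMleq _ _))// -subn1 leq_subLR.
exact: leq_trans (leq_add szi IH) _.
Qed.

(** Two polynomials of size at most [uphalf n] that agree at the
    [uphalf n] - 1 roots of [fibpoly R n] and also at 0, where both are 1. *)
Lemma fibpoly_prod (R : realType) (n : nat) : (0 < n)%N ->
  fibpoly R n =
  \prod_(1 <= j < uphalf n) (1 + (4 * cos (j%:R * pi / n%:R) ^+ 2) *: 'X).
Proof.
move=> n0.
pose th j : R := 4 * cos (j%:R * pi / n%:R) ^+ 2.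
have th0 j : (0 < j)%N -> (2 * j < n)%N -> th j != 0.
  by move=> *; rewrite mulf_neq0 ?pnatr_eq0// expf_neq0// gt_eqF// cos_acute_gt0.
have in_js j : (j \in index_iota 1 (uphalf n)) -> (0 < j)%N /\ (2 * j < n)%N.
  by rewrite mem_index_iota; lia.
pose rs := 0 :: [seq - (th j)^-1 | j <- index_iota 1 (uphalf n)].
have srs : size rs = uphalf n by rewrite /= size_map size_iota; lia.
apply: (@poly_eq_roots _ _ _ rs); rewrite ?srs.
- rewrite /= map_inj_in_uniq ?iota_uniq ?andbT.
    apply/mapP => -[j /in_js[j0 jN] /eqP].
    by rewrite eq_sym oppr_eq0 invr_eq0 (negPf (th0 _ j0 jN)).
  move=> i j /in_js[i0 iN] /in_js[j0 jN] /oppr_inj/invr_inj.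
  have four0 : 4 != 0 :> R by rewrite pnatr_eq0.
  by move/(mulfI four0); apply: cos_sqr_inj.
- exact: size_fibpoly.
- by rewrite (leq_trans (size_prod_affine _ _ _ _))// size_iota; lia.
move=> x; rewrite inE horner_prod => /orP[/eqP->|/mapP[j jin ->]].
  rewrite -(prednK n0) fibpoly_horner0 big1// => i _.
  by rewrite !hornerE.
have [j0 jN] := in_js _ jin.
rewrite (rootP (fibpoly_root _ _ _ j0 jN)) (big_rem j)//=.
rewrite hornerD hornerC hornerZ hornerX.
by rewrite -/(th j) mulrN divff ?th0// subrr mul0r.
Qed.

Lemma fib_prod_cos (R : realType) (n : nat) : (0 < n)%N ->
  (fib n)%:R =
  \prod_(j < n | (0 < j)%N && (2 * j < n)%N)
     (1 + 4 * cos (j%:R * pi / n%:R : R) ^+ 2).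
Proof.
move=> n0; rewrite -fibpoly_horner1 fibpoly_prod// horner_prod.
rewrite (@big_nat_widen _ _ _ _ _ n); last by lia.
rewrite big_geq_mkord; apply: eq_big => [j|j _]; first by lia.
by rewrite !hornerE.
Qed.

(** * Grouping by reduced fractions *)

(** When F j d depends on the fraction j / d only, the terms of F _ n can be
    sorted by the denominator d = n / gcd (j, n) of the reduced form of j / n;
    those with denominator d are j = i k, where n = d k and i is prime to d. *)
Lemma big_lowest_terms (T : Type) (idx : T) (op : Monoid.com_law idx)
    (n : nat) (F : nat -> nat -> T) :
  (0 < n)%N ->
  (forall k j d, (0 < k)%N -> F (j * k)%N (d * k)%N = F j d) ->
  \big[op/idx]_(j < n) F j n =
  \big[op/idx]_(d <- divisors n) \big[op/idx]_(j < d | coprime j d) F j d.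
Proof.
move=> n0 Fk.
have -> : \big[op/idx]_(d <- divisors n) \big[op/idx]_(j < d | coprime j d) F j d
    = \big[op/idx]_(d < n.+1 | (d %| n)%N)
        \big[op/idx]_(j < d | coprime j d) F j d.
  rewrite -(big_mkord (fun d => (d %| n)%N)
    (fun d => \big[op/idx]_(j < d | coprime j d) F j d)) -[RHS]big_filter; apply: perm_big.
  apply: uniq_perm; rewrite ?divisors_uniq ?filter_uniq ?iota_uniq// => d.
  rewrite -dvdn_divisors// mem_filter mem_index_iota /= ltnS.
  by case dn: (d %| n)%N; rewrite // dvdn_leq.
pose den (j : 'I_n) : 'I_n.+1 := inord (n %/ gcdn j n)%N.
have denE j : den j = (n %/ gcdn j n)%N :> nat by rewrite inordK// ltnS leq_div.
rewrite (partition_big den (fun d : 'I_n.+1 => (d %| n)%N)) => [|j _]; last first.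
  by rewrite denE dvdn_div// dvdn_gcdr.
apply: eq_bigr => -[d dn] /= /dvdnP[k nE].
have k0 : (0 < k)%N by lia.
have d0 : (0 < d)%N by lia.
rewrite mulnC in nE.
have up (i : 'I_d) : (i * k < n)%N by rewrite nE ltn_pmul2r.
have dn' (j : 'I_n) : ((j %/ k)%N < d)%N by rewrite ltn_divLR// -nE.
(* The bijection i |-> i k, whose inverse is the division by k. *)
rewrite (reindex_onto (fun i => Ordinal (up i)) (fun j => Ordinal (dn' j))) /=.
  apply: eq_big => [i|i _]; last by rewrite {1}nE Fk.
  rewrite -!val_eqE /= denE /= mulnK// eqxx andbT.
  rewrite {1 2}nE -muln_gcdl divnMr// /coprime.
  have g0 : (0 < gcdn i d)%N by rewrite gcdn_gt0 d0 orbT.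
  apply/eqP/eqP => [e|->]; last by rewrite divn1.
  have := divnK (dvdn_gcdr i d); rewrite e => e'.
  by apply/eqP; rewrite -(eqn_pmul2l d0) e' muln1.
move=> j /=; rewrite -val_eqE /= denE => /eqP e.
apply: val_inj => /=; apply: divnK.
suff -> : k = gcdn j n by rewrite dvdn_gcdl.
have := divnK (dvdn_gcdr j n); rewrite e => /eqP.
by rewrite [X in _ == X]nE eqn_pmul2l// => /eqP.
Qed.

(** In this form the small cases need no exception: for d = 1 and d = 2 the
    product has no factor other than 1, as |5 - 4| = 1 for d = 2. *)
Lemma p_prod_cos (R : realType) (d : nat) : (0 < d)%N ->
  p_ R d = \prod_(j < d | coprime j d)
    (if (0 < j)%N && (2 * j < d)%N
     then 1 + 4 * cos (j%:R * pi / d%:R : R) ^+ 2 else 1).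
Proof.
move=> d0; rewrite -big_mkcondr /p_.
have [->|d1] := eqVneq d 1%N.
  by rewrite big_pred0// => -[[|j] hj]//=; rewrite andbF.
case: d d0 d1 => [|[|[|d]]] // _ _.
  rewrite !hornerE big_pred0 => [|[[|[|j]] hj]]//=; rewrite ?andbF//.
  by rewrite ger0_norm; lra.
have -> : (phi R d.+3).[5] =
    \prod_(j < d.+3 | coprime j d.+3 && ((0 < j)%N && (2 * j < d.+3)%N))
      (1 + 4 * cos (j%:R * pi / d.+3%:R : R) ^+ 2).
  rewrite /phi horner_prod; apply: eq_bigr => j _.
  rewrite hornerD hornerN hornerX hornerC.
  have := cos2Dsin2 (j%:R * pi / d.+3%:R : R).
  set c := cos _; set s := sin _ => cs.
  have -> : s ^+ 2 = 1 - c ^+ 2 by rewrite -cs; ring.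
  by ring.
rewrite ger0_norm// prodr_ge0// => j _.
by rewrite addr_ge0// mulr_ge0// sqr_ge0.
Qed.

Theorem mainTheorem3 (R : realType) (n : nat) (hn : (1 <= n)%N) :
  (fib n)%:R = \prod_(d <- divisors n) p_ R d.
Proof.
pose F j d : R := if (0 < j)%N && (2 * j < d)%N
  then 1 + 4 * cos (j%:R * pi / d%:R) ^+ 2 else 1.
have FM k j d : (0 < k)%N -> F (j * k)%N (d * k)%N = F j d.
  move=> k0; rewrite /F muln_gt0 k0 andbT mulnA ltn_pmul2r// !natrM.
  by rewrite [_ * pi]mulrAC -mulf_div divff ?mulr1// pnatr_eq0 -lt0n.
rewrite fib_prod_cos// big_mkcond /= (big_lowest_terms _ _ _ _ F)//.
rewrite big_seq [RHS]big_seq; apply: eq_bigr => d.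
by rewrite -dvdn_divisors// => /dvdn_gt0 d0; rewrite p_prod_cos ?d0.
Qed.
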